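(* Let $\mathcal E$ be an elementary topos and let $(X,r)$ be an internal equivalence relation in $\mathcal E$. Then the closure operator $\mathsf{cl}\colon PX\to PX$ and the interior operator $\mathsf{int}\colon PX\to PX$ are internally adjoint, $\mathsf{cl}\dashv\mathsf{int}$. Consequently, with comonad $d=\mathsf{int}$ and monad $t=\mathsf{cl}$, the power object $PX$ is an MAO-couple.
   Context: Topos notation. $\top\colon 1\to\Omega$ is the subobject classifier. $PX$ is the power object of $X$ with membership morphism $\in_X\colon X\times PX\to\Omega$; each $f\colon X\times Y\to\Omega$ has a unique transpose $\hat f\colon Y\to PX$ with $\in_X\circ(1\times\hat f)=f$. For $f\colon A\to B$, the inverse image $Pf\colon PB\to PA$ is the transpose of $\in_B\circ(f\times 1)\colon A\times PB\to\Omega$. The direct image $\exists_f\colon PA\to PB$ is the transpose of the classifying morphism of the image of $(f\times 1)m\colon U_A\to B\times PA$, where $m\colon U_A\rightarrowtail A\times PA$ is the subobject classified by $\in_A$. Each $PX$ is an internal Heyting algebra; its order is the equalizer of the meet $\wedge\colon PX\times PX\to PX$ and the first projection, and for $f,g\colon W\to PX$ one writes $f\le g$ when $\langle f,g\rangle$ factors through this order. Relations. A relation $(X,r)$ is a monomorphism $r\colon R\rightarrowtail X\times X$, with classifying morphism $\le_r\colon X\times X\to\Omega$; $r^\dagger$ is $r$ with the two factors of $X\times X$ interchanged. It is an internal equivalence relation if it is reflexive ($\Delta_X\le r$), transitive ($r\otimes r\le r$, where $\otimes$ is composition of relations) and symmetric ($r^\dagger\le r$), $\le$ being inclusion of subobjects.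 The downsegment morphism $\downarrow\colon X\to PX$ is the transpose of $\le_r$, so that $(a\in_X\downarrow b)=(a\le_r b)$; the upsegment morphism $\uparrow\colon X\to PX$ is the transpose of the classifying morphism of $r^\dagger$, so that $(a\in_X\uparrow b)=(b\le_r a)$. The object $PX$ with its own order has a downsegment morphism $\downarrow\colon PX\to P^2X$, and this has an internal left adjoint $\bigvee\colon P^2X\to PX$ (the internal join). Operators. $\mathsf{int}:=P(\uparrow)\circ\downarrow\colon PX\to P^2X\to PX$ (with $\uparrow\colon X\to PX$ and $\downarrow\colon PX\to P^2X$), and $\mathsf{cl}:=\bigvee\circ\exists_{\downarrow}\colon PX\to P^2X\to PX$ (with $\downarrow\colon X\to PX$). Adjunction. For morphisms $f\colon P\rightleftarrows Q\colon g$ of internally preordered objects, $f\dashv g$ means $1\le gf$ and $fg\le 1$. A comonad on a preordered object is an order-preserving endomorphism $d$ with $d\le 1$ and $d\le dd$; a monad is an order-preserving endomorphism $t$ with $1\le t$ and $tt\le t$; idempotent means $dd=d$, resp. $tt=t$. An MAO-couple is an internal Heyting algebra $A$ with an idempotent comonad $d\colon A\to A$ and an idempotent monad $t\colon A\to A$ such that (1) $t\dashv d$ and (2) $t(a\wedge d(b))=t(a)\wedge d(b)$ for all generalized elements $a,b$ of $A$. *)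

(* Defs.v *)
From Corelib Require Import ssreflect ssrfun ssrbool.
From Stdlib Require Import Setoid.

Set Implicit Arguments.
Unset Strict Implicit.
Unset Printing Implicit Defensive.

Declare Scope topos_scope.
Local Open Scope topos_scope.

Record category : Type := Category {
  ob :> Type;
  hom : ob -> ob -> Type;
  idm : forall A, hom A A;
  comp : forall A B C, hom B C -> hom A B -> hom A C;
  comp_idl : forall A B (f : hom A B), comp (idm B) f = f;
  comp_idr : forall A B (f : hom A B), comp f (idm A) = f;
  compA : forall A B C D (h : hom C D) (g : hom B C) (f : hom A B),
    comp h (comp g f) = comp (comp h g) f
}.

Arguments idm {c} A.
Notation "g ∘ f" := (comp g f) (at level 40, left associativity) : topos_scope.

Definition mono (C : category) (A B : C) (m : hom A B) : Prop :=
  forall (W : C) (f g : hom W A), m ∘ f = m ∘ g -> f = g.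

Definition is_pullback (C : category) (P A B D : C)
    (p : hom P A) (q : hom P B) (f : hom A D) (g : hom B D) : Prop :=
  f ∘ p = g ∘ q /\
  forall (W : C) (a : hom W A) (b : hom W B), f ∘ a = g ∘ b ->
    exists! h : hom W P, p ∘ h = a /\ q ∘ h = b.

(* Elementary topos: finite limits (terminal object, binary products,
   equalizers), a subobject classifier and power objects, all of them chosen. *)
Record topos : Type := Topos {
  topos_cat :> category;

  one : topos_cat;
  bang : forall A : topos_cat, hom A one;
  bang_uniq : forall (A : topos_cat) (f : hom A one), f = bang A;

  prod : topos_cat -> topos_cat -> topos_cat;
  pr1 : forall A B : topos_cat, hom (prod A B) A;
  pr2 : forall A B : topos_cat, hom (prod A B) B;
  pair : forall W A B : topos_cat, hom W A -> hom W B -> hom W (prod A B);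
  pr1_pair : forall (W A B : topos_cat) (f : hom W A) (g : hom W B),
    pr1 A B ∘ pair f g = f;
  pr2_pair : forall (W A B : topos_cat) (f : hom W A) (g : hom W B),
    pr2 A B ∘ pair f g = g;
  pair_uniq : forall (W A B : topos_cat) (h : hom W (prod A B)),
    h = pair (pr1 A B ∘ h) (pr2 A B ∘ h);

  eqz : forall (A B : topos_cat) (f g : hom A B), topos_cat;
  eqz_map : forall (A B : topos_cat) (f g : hom A B), hom (eqz f g) A;
  eqz_eq : forall (A B : topos_cat) (f g : hom A B),
    f ∘ eqz_map f g = g ∘ eqz_map f g;
  eqz_univ : forall (A B : topos_cat) (f g : hom A B) (W : topos_cat)
      (h : hom W A), f ∘ h = g ∘ h ->
    exists! k : hom W (eqz f g), eqz_map f g ∘ k = h;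

  Omega : topos_cat;
  tru : hom one Omega;
  chi : forall (S A : topos_cat) (m : hom S A), mono m -> hom A Omega;
  chi_pullback : forall (S A : topos_cat) (m : hom S A) (hm : mono m),
    is_pullback m (bang S) (chi hm) tru;
  chi_uniq : forall (S A : topos_cat) (m : hom S A) (hm : mono m)
      (c : hom A Omega),
    is_pullback m (bang S) c tru -> c = chi hm;

  pow : topos_cat -> topos_cat;
  mem : forall A : topos_cat, hom (prod A (pow A)) Omega;
  transpose : forall A B : topos_cat, hom (prod A B) Omega -> hom B (pow A);
  transpose_mem : forall (A B : topos_cat) (f : hom (prod A B) Omega),
    mem A ∘ pair (pr1 A B) (transpose f ∘ pr2 A B) = f;
  transpose_uniq : forall (A B : topos_cat) (f : hom (prod A B) Omega)
      (g : hom B (pow A)),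
    mem A ∘ pair (pr1 A B) (g ∘ pr2 A B) = f -> g = transpose f
}.

Arguments one {t}.
Arguments bang {t} A.
Arguments pr1 {t} A B.
Arguments pr2 {t} A B.
Arguments Omega {t}.
Arguments tru {t}.
Arguments mem {t} A.
Notation "A × B" := (prod A B) (at level 40, left associativity) : topos_scope.
Notation "⟨ f , g ⟩" := (pair f g) (at level 0, f at level 60, g at level 60)
  : topos_scope.

Definition cross (E : topos) (A B C D : E) (f : hom A B) (g : hom C D) :
  hom (A × C) (B × D) := ⟨f ∘ pr1 A C, g ∘ pr2 A C⟩.

Definition true_at (E : topos) (W : E) : hom W Omega := tru ∘ bang W.
Arguments true_at {E} W.

Section Logic.
Context (E : topos).
Implicit Types A B V W X : E.

Lemma comp_pair V W A B (f : hom W A) (g : hom W B) (h : hom V W) :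
  ⟨f, g⟩ ∘ h = ⟨f ∘ h, g ∘ h⟩.
Proof.
by rewrite {1}(pair_uniq (⟨f, g⟩ ∘ h)) !compA pr1_pair pr2_pair.
Qed.

Lemma pair_inj W A B (f f' : hom W A) (g g' : hom W B) :
  ⟨f, g⟩ = ⟨f', g'⟩ -> f = f' /\ g = g'.
Proof.
move=> e; split.
- by rewrite -(pr1_pair f g) e pr1_pair.
- by rewrite -(pr2_pair f g) e pr2_pair.
Qed.

Lemma true_comp V W (h : hom V W) : true_at W ∘ h = true_at V.
Proof. by rewrite /true_at -compA (bang_uniq (bang W ∘ h)). Qed.

Lemma eqz_mono A B (f g : hom A B) : mono (eqz_map f g).
Proof.
move=> W a b e.
have h : f ∘ (eqz_map f g ∘ b) = g ∘ (eqz_map f g ∘ b).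
  by rewrite !compA eqz_eq.
case: (eqz_univ h) => k [_ u].
by rewrite -(u a e) -(u b eq_refl).
Qed.

Lemma eqz_factor A B (f g : hom A B) W (h : hom W A) :
  f ∘ h = g ∘ h <-> exists k, h = eqz_map f g ∘ k.
Proof.
split=> [e | [k ->]]; last by rewrite !compA eqz_eq.
by case: (eqz_univ e) => k [<- _]; exists k.
Qed.

Lemma mono_pullback_true S A (m : hom S A) (c : hom A Omega) : mono m ->
  (forall W (h : hom W A), c ∘ h = true_at W <-> exists k, h = m ∘ k) ->
  is_pullback m (bang S) c tru.
Proof.
move=> hm hc; split.
  by apply/hc; exists (idm S); rewrite comp_idr.
move=> W a b e.
have {e} /hc [k ek] : c ∘ a = true_at W by rewrite e (bang_uniq b).
exists k; split=> [|k' [e' _]]; last by apply: hm; rewrite e' ek.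
by split; [rewrite ek | rewrite (bang_uniq b); apply: bang_uniq].
Qed.

Lemma chi_true S A (m : hom S A) (hm : mono m) W (h : hom W A) :
  chi hm ∘ h = true_at W <-> exists k, h = m ∘ k.
Proof.
case: (chi_pullback hm) => e u; split=> [eh | [k ->]].
  by case: (u W h (bang W) eh) => k [[<- _] _]; exists k.
by rewrite compA e -compA (bang_uniq (bang S ∘ k)).
Qed.

Lemma omega_ext W (p q : hom W Omega) :
  (forall V (h : hom V W), p ∘ h = true_at V <-> q ∘ h = true_at V) -> p = q.
Proof.
move=> pq.
have hm := @eqz_mono W Omega p (true_at W).
have key c : (forall V (h : hom V W),
    c ∘ h = true_at V <-> p ∘ h = true_at V) -> c = chi hm.
  move=> hc; apply: chi_uniq; apply: mono_pullback_true => // V h.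
  rewrite hc -[X in _ = X](true_comp h); exact: eqz_factor.
by rewrite (key p) // (key q) // => V h; split=> /pq.
Qed.

Lemma diag_mono A : mono ⟨idm A, idm A⟩.
Proof.
by move=> W f g; rewrite !comp_pair !comp_idl => /pair_inj [].
Qed.

Definition eqO A : hom (A × A) Omega := chi (@diag_mono A).

Lemma eqOP A W (a b : hom W A) : eqO A ∘ ⟨a, b⟩ = true_at W <-> a = b.
Proof.
rewrite /eqO chi_true; split=> [[k] | <-].
  by rewrite comp_pair comp_idl => /pair_inj [-> ->].
by exists a; rewrite comp_pair comp_idl.
Qed.

Lemma tt_mono : mono ⟨@tru E, @tru E⟩.
Proof. by move=> W f g _; rewrite (bang_uniq f) (bang_uniq g). Qed.

(* The connectives are locked because -compA would otherwise unfold them. *)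
Definition andO A (p q : hom A Omega) : hom A Omega :=
  locked (chi tt_mono ∘ ⟨p, q⟩).

Lemma andOP A (p q : hom A Omega) W (a : hom W A) :
  andO p q ∘ a = true_at W <-> p ∘ a = true_at W /\ q ∘ a = true_at W.
Proof.
rewrite /andO -lock -compA comp_pair chi_true; split=> [[k] | [-> ->]].
  rewrite comp_pair => /pair_inj [-> ->].
  by rewrite /true_at (bang_uniq k).
by exists (bang W); rewrite comp_pair.
Qed.

Definition impO A (p q : hom A Omega) : hom A Omega :=
  locked (eqO Omega ∘ ⟨andO p q, p⟩).

Lemma impOP A (p q : hom A Omega) W (a : hom W A) :
  impO p q ∘ a = true_at W <->
  forall V (h : hom V W), p ∘ (a ∘ h) = true_at V -> q ∘ (a ∘ h) = true_at V.
Proof.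
rewrite /impO -lock -compA comp_pair eqOP; split=> [e V h hp | hpq].
  suff /andOP [] : andO p q ∘ (a ∘ h) = true_at V by [].
  by rewrite compA e -compA.
apply: omega_ext => V h.
rewrite -[andO p q ∘ a ∘ h]compA -[p ∘ a ∘ h]compA andOP.
by split=> [[] | hp] //; split=> //; apply: hpq.
Qed.

Lemma mem_transpose A B (f : hom (A × B) Omega) W (a : hom W A) (b : hom W B) :
  mem A ∘ ⟨a, transpose f ∘ b⟩ = f ∘ ⟨a, b⟩.
Proof.
rewrite -{2}(transpose_mem f) -compA comp_pair -compA.
by rewrite pr1_pair pr2_pair.
Qed.

Lemma pow_ext A W (u v : hom W (pow A)) :
  (forall V (h : hom V W) (a : hom V A),
     mem A ∘ ⟨a, u ∘ h⟩ = true_at V <-> mem A ∘ ⟨a, v ∘ h⟩ = true_at V) ->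
  u = v.
Proof.
move=> uv.
rewrite (transpose_uniq (eq_refl (mem A ∘ ⟨pr1 A W, u ∘ pr2 A W⟩))).
apply/esym/transpose_uniq/omega_ext => V h.
by rewrite -!compA !comp_pair -!compA; split=> /uv.
Qed.

Definition allO A B (p : hom (A × B) Omega) : hom B Omega :=
  locked (eqO (pow A) ∘ ⟨transpose p, transpose (true_at (A × B))⟩).

Lemma allOP A B (p : hom (A × B) Omega) W (b : hom W B) :
  allO p ∘ b = true_at W <->
  forall V (h : hom V W) (a : hom V A), p ∘ ⟨a, b ∘ h⟩ = true_at V.
Proof.
rewrite /allO -lock -compA comp_pair eqOP; split=> [e V h a | hp].
  by rewrite -mem_transpose compA e -compA mem_transpose true_comp.
by apply: pow_ext => V h a; rewrite -!compA !mem_transpose true_comp hp.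
Qed.

End Logic.

Local Ltac nrm :=
  rewrite -?compA;
  repeat (progress rewrite ?comp_pair ?pr1_pair ?pr2_pair -?compA).

(* Inclusion of subobjects; more generally, f factors through n *)
Definition factors (E : topos) (A B N : E) (f : hom A B) (n : hom N B) : Prop :=
  exists k : hom A N, f = n ∘ k.

Record image_of (E : topos) (A B : E) (f : hom A B) : Type := Image {
  im_ob : E;
  im_map : hom im_ob B;
  im_mono : mono im_map;
  im_factor : factors f im_map;
  im_min : forall (N : E) (n : hom N B), mono n -> factors f n ->
    factors im_map n
}.

Arguments im_mono {E A B f} _.

Section Image.
Context (E : topos) (A B : E) (f : hom A B).

(* b belongs to the image iff b lies in every U : PB containing all f a *)
Definition image_pred : hom B Omega :=
  allO (impO (allO (mem B ∘ ⟨f ∘ pr1 A (pow B × B),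
                             pr1 (pow B) B ∘ pr2 A (pow B × B)⟩))
             (mem B ∘ ⟨pr2 (pow B) B, pr1 (pow B) B⟩)).

Lemma image_predP W (b : hom W B) : image_pred ∘ b = true_at W <->
  forall V (h : hom V W) (U : hom V (pow B)),
    (forall V' (h' : hom V' V) (a : hom V' A),
       mem B ∘ ⟨f ∘ a, U ∘ h'⟩ = true_at V') ->
    mem B ∘ ⟨b ∘ h, U⟩ = true_at V.
Proof.
rewrite /image_pred allOP; split=> [H V h U HU | H V h U].
  move/impOP: (H V h U) => /(_ V (idm V)).
  rewrite comp_idr; nrm; apply.
  by apply/allOP => V' h' a; nrm; apply: HU.
apply/impOP => V' h'.
rewrite !comp_pair => /allOP HU.
nrm; apply: H => V2 h2 a; move: (HU V2 h2 a); by nrm.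
Qed.

Definition image : image_of f.
Proof.
exists (eqz image_pred (true_at B)) (eqz_map image_pred (true_at B)).
- exact: eqz_mono.
- apply/eqz_factor; rewrite true_comp.
  apply/image_predP => V h U HU.
  by move: (HU V (idm V) h); rewrite comp_idr.
- move=> N n hn [k ek].
  set m := eqz_map _ _.
  have /image_predP Hm : image_pred ∘ m = true_at _ by rewrite eqz_eq true_comp.
  set U := transpose (chi hn ∘ pr1 B (eqz image_pred (true_at B))).
  have memU V (h : hom V (eqz image_pred (true_at B))) (b : hom V B) :
      mem B ∘ ⟨b, U ∘ h⟩ = true_at V <-> factors b n.
    by rewrite /U mem_transpose -compA pr1_pair; apply: chi_true.
  apply/(memU _ (idm _)).
  rewrite comp_idr -{1}(comp_idr m); apply: Hm => V' h' a.
  by apply/memU; exists (k ∘ a); rewrite ek compA.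
Defined.

Lemma imageP W (b : hom W B) :
  factors b (im_map image) <-> image_pred ∘ b = true_at W.
Proof. by rewrite -(true_comp b); split=> /eqz_factor. Qed.

End Image.

Section Relations.
Context (E : topos).

Record relation (X : E) : Type := Relation {
  rel_ob : E;
  rel_map : hom rel_ob (X × X);
  rel_mono : mono rel_map
}.

Arguments rel_mono {X} r.

Definition rel_incl (X : E) (r s : relation X) : Prop :=
  factors (rel_map r) (rel_map s).

Definition rel_chi (X : E) (r : relation X) : hom (X × X) Omega :=
  chi (rel_mono r).

Definition rel_diag (X : E) : relation X := Relation (@diag_mono E X).

Definition swap (X : E) : hom (X × X) (X × X) := ⟨pr2 X X, pr1 X X⟩.

Lemma swapK (X : E) : swap X ∘ swap X = idm (X × X).
Proof.
rewrite /swap comp_pair pr1_pair pr2_pair.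
by rewrite [RHS]pair_uniq !comp_idr.
Qed.

Lemma dagger_mono (X : E) (r : relation X) : mono (swap X ∘ rel_map r).
Proof.
move=> W f g e; apply: (@rel_mono X r).
rewrite -[LHS]comp_idl -[RHS]comp_idl -swapK -!compA.
by congr (_ ∘ _); rewrite !compA.
Qed.

Definition dagger (X : E) (r : relation X) : relation X :=
  Relation (@dagger_mono X r).

(* The pullback of pr2 ∘ r and pr1 ∘ s, built as an equalizer *)
Definition comp_ob (X : E) (r s : relation X) : E :=
  eqz (pr2 X X ∘ rel_map r ∘ pr1 (rel_ob r) (rel_ob s))
      (pr1 X X ∘ rel_map s ∘ pr2 (rel_ob r) (rel_ob s)).

Definition comp_map (X : E) (r s : relation X) : hom (comp_ob r s) (X × X) :=
  ⟨pr1 X X ∘ rel_map r ∘ pr1 (rel_ob r) (rel_ob s),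
   pr2 X X ∘ rel_map s ∘ pr2 (rel_ob r) (rel_ob s)⟩ ∘ eqz_map _ _.

Definition rel_comp (X : E) (r s : relation X) : relation X :=
  Relation (im_mono (image (comp_map r s))).

Definition reflexive (X : E) (r : relation X) : Prop := rel_incl (rel_diag X) r.
Definition transitive (X : E) (r : relation X) : Prop :=
  rel_incl (rel_comp r r) r.
Definition symmetric (X : E) (r : relation X) : Prop := rel_incl (dagger r) r.

Definition equivalence_relation (X : E) (r : relation X) : Prop :=
  reflexive r /\ transitive r /\ symmetric r.

Definition rel_le (X : E) (r : relation X) (W : E) (f g : hom W X) : Prop :=
  factors ⟨f, g⟩ (rel_map r).

Record preordered : Type := Preordered {
  pre_ob :> E;
  pre_rel : relation pre_ob;
  pre_refl : reflexive pre_rel;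
  pre_trans : transitive pre_rel
}.

Definition le (P : preordered) (W : E) (f g : hom W P) : Prop :=
  rel_le (pre_rel P) f g.

Definition order_preserving (P Q : preordered) (f : hom P Q) : Prop :=
  forall (W : E) (a b : hom W P), le a b -> le (f ∘ a) (f ∘ b).

(* Arrows between preordered objects are order-preserving; without this the
   two inequalities would not determine a left adjoint. *)
Definition adjoint (P Q : preordered) (f : hom P Q) (g : hom Q P) : Prop :=
  [/\ order_preserving f, order_preserving g,
      le (idm P) (g ∘ f) & le (f ∘ g) (idm Q)].

Definition comonad (P : preordered) (d : hom P P) : Prop :=
  [/\ order_preserving d, le d (idm P) & le d (d ∘ d)].

Definition monad (P : preordered) (t : hom P P) : Prop :=
  [/\ order_preserving t, le (idm P) t & le (t ∘ t) t].

Definition idempotent (A : E) (f : hom A A) : Prop := f ∘ f = f.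

(* mem ∘ ⟨a, downseg r ∘ b⟩ is the truth value of a ≤ b, and with upseg of
   b ≤ a. *)
Definition downseg (X : E) (r : relation X) : hom X (pow X) :=
  transpose (rel_chi r).

Definition upseg (X : E) (r : relation X) : hom X (pow X) :=
  transpose (rel_chi (dagger r)).

Definition inverse_image (A B : E) (f : hom A B) : hom (pow B) (pow A) :=
  transpose (mem B ∘ cross f (idm (pow B))).

(* U_A, the subobject of A × PA classified by membership *)
Definition mem_ob (A : E) : E := eqz (mem A) (true_at (A × pow A)).
Definition mem_sub (A : E) : hom (mem_ob A) (A × pow A) :=
  eqz_map (mem A) (true_at (A × pow A)).

Lemma mem_sub_mono (A : E) : mono (mem_sub A).
Proof. exact: eqz_mono. Qed.

Lemma mem_sub_chi (A : E) : chi (@mem_sub_mono A) = mem A.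
Proof.
apply/esym/chi_uniq/mono_pullback_true => [|W h]; first exact: mem_sub_mono.
by rewrite -(true_comp h); apply: eqz_factor.
Qed.

Definition direct_image (A B : E) (f : hom A B) : hom (pow A) (pow B) :=
  transpose (chi (im_mono (image (cross f (idm (pow A)) ∘ mem_sub A)))).

(* Identities are stated for generalized elements, which by Yoneda amounts to
   the commutativity of the corresponding diagrams. *)
Record heyting : Type := Heyting {
  hey_ob :> E;
  htop : hom one hey_ob;
  hbot : hom one hey_ob;
  hmeet : hom (hey_ob × hey_ob) hey_ob;
  hjoin : hom (hey_ob × hey_ob) hey_ob;
  himp : hom (hey_ob × hey_ob) hey_ob;
  hmeetC : forall W (a b : hom W hey_ob), hmeet ∘ ⟨a, b⟩ = hmeet ∘ ⟨b, a⟩;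
  hmeetA : forall W (a b c : hom W hey_ob),
    hmeet ∘ ⟨a, hmeet ∘ ⟨b, c⟩⟩ = hmeet ∘ ⟨hmeet ∘ ⟨a, b⟩, c⟩;
  hjoinC : forall W (a b : hom W hey_ob), hjoin ∘ ⟨a, b⟩ = hjoin ∘ ⟨b, a⟩;
  hjoinA : forall W (a b c : hom W hey_ob),
    hjoin ∘ ⟨a, hjoin ∘ ⟨b, c⟩⟩ = hjoin ∘ ⟨hjoin ∘ ⟨a, b⟩, c⟩;
  hmeetK : forall W (a b : hom W hey_ob), hmeet ∘ ⟨a, hjoin ∘ ⟨a, b⟩⟩ = a;
  hjoinK : forall W (a b : hom W hey_ob), hjoin ∘ ⟨a, hmeet ∘ ⟨a, b⟩⟩ = a;
  hmeet1 : forall W (a : hom W hey_ob), hmeet ∘ ⟨a, htop ∘ bang W⟩ = a;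
  hjoin0 : forall W (a : hom W hey_ob), hjoin ∘ ⟨a, hbot ∘ bang W⟩ = a;
  himpP : forall W (a b c : hom W hey_ob),
    hmeet ∘ ⟨hmeet ∘ ⟨a, b⟩, c⟩ = hmeet ∘ ⟨a, b⟩ <->
    hmeet ∘ ⟨a, himp ∘ ⟨b, c⟩⟩ = a
}.

Definition hey_rel (A : heyting) : relation A :=
  Relation (@eqz_mono E _ _ (hmeet A) (pr1 A A)).

Lemma hey_relP (A : heyting) W (a b : hom W A) :
  rel_le (hey_rel A) a b <-> hmeet A ∘ ⟨a, b⟩ = a.
Proof.
by rewrite /rel_le /factors /hey_rel /= -eqz_factor pr1_pair.
Qed.

Lemma hmeetI (A : heyting) W (a : hom W A) : hmeet A ∘ ⟨a, a⟩ = a.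
Proof. by rewrite -{2}(hjoinK a a) hmeetK. Qed.

Lemma hey_refl (A : heyting) : reflexive (hey_rel A).
Proof. by apply/hey_relP; apply: hmeetI. Qed.

Lemma comp_minimal (X : E) (r s t : relation X) :
  (forall W (a b c : hom W X), rel_le r a b -> rel_le s b c -> rel_le t a c) ->
  rel_incl (rel_comp r s) t.
Proof.
move=> H; apply: im_min; first exact: (rel_mono t).
rewrite /comp_map comp_pair /comp_ob.
set p1 := pr1 (rel_ob r) _; set p2 := pr2 (rel_ob r) _.
set u := pr2 X X ∘ rel_map r ∘ p1; set v := pr1 X X ∘ rel_map s ∘ p2.
move: (eqz u v) (eqz_map u v) (eqz_eq u v) => K e; rewrite /u /v => ee.
apply: (H _ _ (pr2 X X ∘ rel_map r ∘ p1 ∘ e)).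
  by exists (p1 ∘ e); rewrite -!compA -pair_uniq.
exists (p2 ∘ e); rewrite ee -!compA; exact/esym/pair_uniq.
Qed.

Lemma hey_trans (A : heyting) : transitive (hey_rel A).
Proof.
apply: comp_minimal => W a b c /hey_relP ab /hey_relP bc; apply/hey_relP.
by rewrite -{1}ab -hmeetA bc.
Qed.

Definition hey_pre (A : heyting) : preordered :=
  Preordered (@hey_refl A) (@hey_trans A).

Definition MAO_couple (A : heyting) (d t : hom A A) : Prop :=
  (comonad (P := hey_pre A) d /\ idempotent d) /\
  (monad (P := hey_pre A) t /\ idempotent t) /\
  adjoint (P := hey_pre A) (Q := hey_pre A) t d /\
  (forall (W : E) (a b : hom W A),
     t ∘ (hmeet A ∘ ⟨a, d ∘ b⟩) = hmeet A ∘ ⟨t ∘ a, d ∘ b⟩).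

End Relations.

Section PowerHeyting.
Context (E : topos) (X : E).
Notation PX := (pow X).

Definition is_in W (x : hom W X) (u : hom W PX) : Prop :=
  mem X ∘ ⟨x, u⟩ = true_at W.

Lemma is_in_comp V W (h : hom V W) (x : hom W X) (u : hom W PX) :
  is_in x u -> is_in (x ∘ h) (u ∘ h).
Proof. by rewrite /is_in -comp_pair compA => ->; rewrite true_comp. Qed.

(* the predicates x ∈ u and x ∈ v in the context (x, (u, v)) *)
Definition in_fst : hom (X × (PX × PX)) Omega :=
  mem X ∘ ⟨pr1 X (PX × PX), pr1 PX PX ∘ pr2 X (PX × PX)⟩.
Definition in_snd : hom (X × (PX × PX)) Omega :=
  mem X ∘ ⟨pr1 X (PX × PX), pr2 PX PX ∘ pr2 X (PX × PX)⟩.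

Lemma in_fstE W (x : hom W X) (u v : hom W PX) :
  in_fst ∘ ⟨x, ⟨u, v⟩⟩ = mem X ∘ ⟨x, u⟩.
Proof. by rewrite /in_fst -compA comp_pair -compA pr1_pair pr2_pair pr1_pair. Qed.

Lemma in_sndE W (x : hom W X) (u v : hom W PX) :
  in_snd ∘ ⟨x, ⟨u, v⟩⟩ = mem X ∘ ⟨x, v⟩.
Proof. by rewrite /in_snd -compA comp_pair -compA pr1_pair !pr2_pair. Qed.

Definition pow_top : hom one PX := transpose (true_at (X × one)).

Definition pow_bot : hom one PX := transpose (allO (pr1 Omega (X × one))).

Definition pow_meet : hom (PX × PX) PX := transpose (andO in_fst in_snd).

(* x ∈ u ∨ v iff every truth value implied by both x ∈ u and x ∈ v holds *)
Definition pow_join : hom (PX × PX) PX :=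
  let p := pr1 Omega (X × (PX × PX)) in
  let c := pr2 Omega (X × (PX × PX)) in
  transpose (allO (impO (andO (impO (in_fst ∘ c) p) (impO (in_snd ∘ c) p)) p)).

Definition pow_imp : hom (PX × PX) PX := transpose (impO in_fst in_snd).

Lemma pow_topP W (x : hom W X) : is_in x (pow_top ∘ bang W).
Proof. by rewrite /is_in mem_transpose true_comp. Qed.

Lemma pow_botP W (x : hom W X) (u : hom W PX) :
  is_in x (pow_bot ∘ bang W) -> is_in x u.
Proof.
rewrite /is_in mem_transpose => /allOP /(_ W (idm W) (mem X ∘ ⟨x, u⟩)).
by rewrite pr1_pair.
Qed.

Lemma pow_meetP W (x : hom W X) (u v : hom W PX) :
  is_in x (pow_meet ∘ ⟨u, v⟩) <-> is_in x u /\ is_in x v.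
Proof. by rewrite /is_in mem_transpose andOP in_fstE in_sndE. Qed.

Lemma pow_impP W (x : hom W X) (u v : hom W PX) :
  is_in x (pow_imp ∘ ⟨u, v⟩) <->
  forall V (h : hom V W), is_in (x ∘ h) (u ∘ h) -> is_in (x ∘ h) (v ∘ h).
Proof.
rewrite /is_in mem_transpose impOP; split=> H V h; move: (H V h);
  by rewrite !comp_pair in_fstE in_sndE.
Qed.

Lemma pow_joinP W (x : hom W X) (u v : hom W PX) :
  is_in x (pow_join ∘ ⟨u, v⟩) <->
  forall V (h : hom V W) (p : hom V Omega),
    (forall V' (h' : hom V' V), is_in (x ∘ h ∘ h') (u ∘ h ∘ h') ->
       p ∘ h' = true_at V') ->
    (forall V' (h' : hom V' V), is_in (x ∘ h ∘ h') (v ∘ h ∘ h') ->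
       p ∘ h' = true_at V') ->
    p = true_at V.
Proof.
rewrite /is_in /pow_join mem_transpose allOP; split=> [H V h p Hu Hv | H V h p].
  move/impOP: (H V h p) => /(_ V (idm V)).
  rewrite comp_idr pr1_pair; apply.
  rewrite !comp_pair; apply/andOP; split; apply/impOP => V' h';
    rewrite -compA !comp_pair pr1_pair pr2_pair ?in_fstE ?in_sndE; [exact: Hu|exact: Hv].
apply/impOP => V' h'.
rewrite !comp_pair pr1_pair => /andOP [/impOP Hu /impOP Hv].
move: (H V' (h ∘ h') (p ∘ h')); rewrite !compA; apply=> V2 h2.
  move: (Hu V2 h2); by rewrite -compA !comp_pair pr1_pair pr2_pair in_fstE.
move: (Hv V2 h2); by rewrite -compA !comp_pair pr1_pair pr2_pair in_sndE.
Qed.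

Definition subset W (u v : hom W PX) : Prop :=
  forall V (h : hom V W) (x : hom V X), is_in x (u ∘ h) -> is_in x (v ∘ h).

Lemma subset_anti W (u v : hom W PX) : subset u v -> subset v u -> u = v.
Proof. by move=> uv vu; apply: pow_ext => V h x; split; [apply: uv|apply: vu]. Qed.

Lemma subset_trans W (u v w : hom W PX) :
  subset u v -> subset v w -> subset u w.
Proof. by move=> uv vw V h x /uv /vw. Qed.

Lemma meet_subset W (u v : hom W PX) :
  pow_meet ∘ ⟨u, v⟩ = u <-> subset u v.
Proof.
split=> [e V h x | uv].
  by rewrite -{1}e -compA comp_pair => /pow_meetP [].
apply: subset_anti => V h x; rewrite -compA comp_pair; first by case/pow_meetP.
by move=> xu; apply/pow_meetP; split=> //; apply: uv.
Qed.

Lemma subset_join W (u v w : hom W PX) :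
  subset (pow_join ∘ ⟨u, v⟩) w <-> subset u w /\ subset v w.
Proof.
split=> [H | [Hu Hv] V h x].
  have trans3 z : subset z (pow_join ∘ ⟨u, v⟩) -> subset z w.
    by move=> /subset_trans; apply.
  split; apply: trans3 => V h x xz; rewrite -compA comp_pair;
    apply/pow_joinP => V' h' p Hu Hv; rewrite -(comp_idr p).
    by apply: Hu; rewrite !comp_idr; apply: is_in_comp.
  by apply: Hv; rewrite !comp_idr; apply: is_in_comp.
rewrite -compA comp_pair => /pow_joinP /(_ V (idm V) (mem X ∘ ⟨x, w ∘ h⟩)).
apply=> V' h'; rewrite !comp_idr -!compA comp_pair -compA; [exact: Hu|exact: Hv].
Qed.

Lemma subset_refl W (u : hom W PX) : subset u u.
Proof. by []. Qed.

Lemma join_lub W (u v w : hom W PX) : subset u w -> subset v w ->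
  subset (pow_join ∘ ⟨u, v⟩) w.
Proof. by move=> *; apply/subset_join. Qed.

Lemma join_ub W (u v : hom W PX) : subset u (pow_join ∘ ⟨u, v⟩) /\
  subset v (pow_join ∘ ⟨u, v⟩).
Proof. exact/subset_join/subset_refl. Qed.

Definition power_heyting : heyting E.
Proof.
refine (@Heyting E PX pow_top pow_bot pow_meet pow_join pow_imp
  _ _ _ _ _ _ _ _ _).
- by move=> W a b; apply: pow_ext => V h x; rewrite -!compA !comp_pair;
  split=> /pow_meetP [? ?]; apply/pow_meetP.
- move=> W a b c; apply: pow_ext => V h x.
  rewrite -!compA !comp_pair -!compA !comp_pair.
  split=> /pow_meetP [].
    by move=> xa /pow_meetP [xb xc]; apply/pow_meetP; split=> //; apply/pow_meetP.
  by move=> /pow_meetP [xa xb] xc; apply/pow_meetP; split=> //; apply/pow_meetP.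
- move=> W a b.
  have [aL bL] := join_ub a b; have [bR aR] := join_ub b a.
  by apply: subset_anti; apply: join_lub.
- move=> W a b c.
  have [bbc cbc] := join_ub b c; have [aab bab] := join_ub a b.
  have [a1 bc1] := join_ub a (pow_join ∘ ⟨b, c⟩).
  have [ab2 c2] := join_ub (pow_join ∘ ⟨a, b⟩) c.
  apply: subset_anti; repeat apply: join_lub => //.
  + exact: subset_trans ab2.
  + exact: subset_trans bab ab2.
  + exact: subset_trans bc1.
  + exact: subset_trans cbc bc1.
- by move=> W a b; apply/meet_subset; case: (join_ub a b).
- move=> W a b; apply: subset_anti; last by case: (join_ub a (pow_meet ∘ ⟨a, b⟩)).
  apply: join_lub => // V h x; rewrite -compA comp_pair.
  by case/pow_meetP.
- move=> W a; apply/meet_subset => V h x _.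
  by rewrite -compA (bang_uniq (bang W ∘ h)); apply: pow_topP.
- move=> W a; apply: subset_anti; last by case: (join_ub a (pow_bot ∘ bang W)).
  apply: join_lub => // V h x.
  by rewrite -compA (bang_uniq (bang W ∘ h)); apply: pow_botP.
- move=> W a b c; rewrite !meet_subset; split=> H V h x.
    move=> xa; rewrite -compA comp_pair; apply/pow_impP => V' h' xb.
    rewrite -compA; apply: H; rewrite -compA comp_pair; apply/pow_meetP.
    split; last by rewrite compA.
    by rewrite compA; apply: is_in_comp.
  rewrite -compA comp_pair => /pow_meetP [/H].
  rewrite -compA comp_pair => /pow_impP /(_ V (idm V)).
  by rewrite !comp_idr.
Defined.

Definition power_pre : preordered E := hey_pre power_heyting.

Lemma power_leP W (u v : hom W PX) :
  le (P := power_pre) u v <-> subset u v.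
Proof.
rewrite -meet_subset; exact: (hey_relP (A := power_heyting)).
Qed.

End PowerHeyting.

Section Operators.
Context (E : topos) (X : E).
Notation PX := (pow X).
Notation PPX := (pow (pow X)).

Definition down_pow : hom PX PPX := downseg (pre_rel (power_pre X)).

Lemma down_powP W (u v : hom W PX) : is_in u (down_pow ∘ v) <-> subset u v.
Proof.
rewrite -power_leP /is_in mem_transpose /rel_chi; exact: chi_true.
Qed.

(* Left adjoints between partial orders are unique, so it is harmless to build
   one explicitly: ⋁ T is the intersection of all S : PX such that T ≤ ↓ S. *)
Definition upper_pred : hom (PX × (X × PPX)) Omega :=
  rel_chi (pre_rel (power_pre PX)) ∘
  ⟨pr2 X PPX ∘ pr2 PX (X × PPX), down_pow ∘ pr1 PX (X × PPX)⟩.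

Definition join_map : hom PPX PX :=
  transpose (allO (impO upper_pred
    (mem X ∘ ⟨pr1 X PPX ∘ pr2 PX (X × PPX), pr1 PX (X × PPX)⟩))).

Lemma join_mapP W (x : hom W X) (T : hom W PPX) :
  is_in x (join_map ∘ T) <->
  forall V (h : hom V W) (S : hom V PX),
    subset (T ∘ h) (down_pow ∘ S) -> is_in (x ∘ h) S.
Proof.
have upperP V (S : hom V PX) (y : hom V X) (T' : hom V PPX) :
    upper_pred ∘ ⟨S, ⟨y, T'⟩⟩ = true_at V <-> subset T' (down_pow ∘ S).
  rewrite /upper_pred -compA comp_pair -!compA pr1_pair !pr2_pair -power_leP.
  exact: chi_true.
rewrite /is_in mem_transpose allOP; split=> [H V h S HS | H V h S].
  move/impOP: (H V h S) => /(_ V (idm V)).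
  rewrite comp_idr comp_pair upperP => /(_ HS).
  by rewrite -compA comp_pair -compA pr1_pair pr2_pair pr1_pair.
apply/impOP => V' h'; rewrite !comp_pair => /upperP HS.
rewrite -compA comp_pair -compA pr1_pair pr2_pair pr1_pair -compA.
by apply: H; rewrite compA.
Qed.

Definition join_sig :
  {j : hom PPX PX | adjoint (P := power_pre PX) (Q := power_pre X) j down_pow}.
Proof.
exists join_map; split.
- move=> W S T /power_leP ST; apply/power_leP => V h x.
  rewrite -!compA => /join_mapP H; apply/join_mapP => V' h' U HU; apply: H => V2 h2 y Hy.
  by apply: HU; move: Hy; rewrite -!compA; apply: ST.
- move=> W u v /power_leP uv; apply/power_leP => V h y.
  rewrite -!compA => /down_powP H; apply/down_powP => V' h' x /H.
  by rewrite -!compA; apply: uv.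
- apply/power_leP => V h y; rewrite comp_idl -!compA => Hy.
  apply/down_powP => V' h' x Hx.
  rewrite -compA; apply/join_mapP => V2 h2 S HS.
  have /down_powP H : is_in (y ∘ h' ∘ h2) (down_pow ∘ S).
    rewrite -[down_pow ∘ S]comp_idr; apply: HS.
    rewrite comp_idr; move: (is_in_comp (h' ∘ h2) Hy); by rewrite !compA.
  rewrite -[S]comp_idr; apply: H; rewrite comp_idr; exact: is_in_comp.
- apply/power_leP => V h x; rewrite -!compA comp_idl => /join_mapP.
  move=> /(_ V (idm V) h); rewrite !comp_idr; apply; exact: subset_refl.
Defined.

Definition bigjoin : hom PPX PX := proj1_sig join_sig.

Context (r : relation X).

Definition interior_op : hom PX PX := inverse_image (upseg r) ∘ down_pow.

Definition closure_op : hom PX PX := bigjoin ∘ direct_image (downseg r).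

End Operators.

(* Main.v *)
(** Writing [↓] for [downseg r], the closure operator is left adjoint to
    [P(↓) ∘ ↓], because [⋁ ⊣ ↓] and [∃_f ⊣ P f].  Symmetry of [r] means that the
    upsegment and downsegment morphisms agree, so this right adjoint is the
    interior operator.  Pointwise, [x] lies in the interior of [u] iff the class
    of [x] is contained in [u]; reflexivity and transitivity then make
    the interior operator an idempotent comonad, and the monad laws for its left
    adjoint follow formally.  For the Frobenius law one transposes twice, to
    [a ≤ int (int b ⇒ cl (a ∧ int b))]: if [x ∈ a] is equivalent to [y ∈ int b],
    then [x ∈ int b] as interiors are unions of classes, so [y] is equivalent
    to an element of [a ∧ int b]. *)

From Corelib Require Import ssreflect ssrfun ssrbool.
Require Import Defs.

Set Implicit Arguments.
Unset Strict Implicit.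
Unset Printing Implicit Defensive.

Local Open Scope topos_scope.

(** * Relations on generalized elements *)

Section RelationElements.
Context (E : topos) (X : E) (r : relation X).

Lemma rel_le_comp V W (h : hom V W) (a b : hom W X) :
  rel_le r a b -> rel_le r (a ∘ h) (b ∘ h).
Proof. by case=> k e; exists (k ∘ h); rewrite -comp_pair e compA. Qed.

Lemma rel_le_refl W (a : hom W X) : reflexive r -> rel_le r a a.
Proof.
case=> k e; exists (k ∘ a).
by rewrite compA -e /= comp_pair comp_idl.
Qed.

(** The witnesses [k] and [l] agree on the middle element [b], so [⟨k, l⟩] lifts to the equalizer
    underlying the composite, which maps into the image. *)
Lemma rel_comp_intro (s : relation X) W (a b c : hom W X) :
  rel_le r a b -> rel_le s b c -> rel_le (rel_comp r s) a c.
Proof.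
case=> k ek [l el].
have [m em] : factors ⟨a, c⟩ (comp_map r s).
  have e : pr2 X X ∘ rel_map r ∘ pr1 _ _ ∘ ⟨k, l⟩
         = pr1 X X ∘ rel_map s ∘ pr2 _ _ ∘ ⟨k, l⟩.
    by rewrite -!compA pr1_pair pr2_pair -ek -el pr1_pair pr2_pair.
  case/eqz_factor: e => m em; exists m.
  rewrite /comp_map -[RHS](compA _ _ m) -em comp_pair -!compA !pr1_pair !pr2_pair.
  by rewrite -ek -el pr1_pair pr2_pair.
have [n en] := im_factor (image (comp_map r s)).
by exists (n ∘ m); rewrite em [RHS]compA -en.
Qed.

Lemma rel_le_trans W (a b c : hom W X) :
  transitive r -> rel_le r a b -> rel_le r b c -> rel_le r a c.
Proof.
move=> [k e] ab bc; case: (rel_comp_intro ab bc) => l el.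
by exists (k ∘ l); rewrite el e compA.
Qed.

Lemma rel_le_dagger W (a b : hom W X) :
  rel_le (dagger r) a b <-> rel_le r b a.
Proof.
have swap_pair (c d : hom W X) : swap X ∘ ⟨c, d⟩ = ⟨d, c⟩.
  by rewrite /swap comp_pair pr1_pair pr2_pair.
split=> -[k e]; exists k.
  by rewrite -swap_pair e /= !compA swapK comp_idl.
by rewrite /= -compA -e swap_pair.
Qed.

Lemma rel_le_sym W (a b : hom W X) :
  symmetric r -> rel_le r a b -> rel_le r b a.
Proof.
move=> [k e] /rel_le_dagger [l el].
by exists (k ∘ l); rewrite el e compA.
Qed.

Lemma downsegP W (a b : hom W X) :
  is_in a (downseg r ∘ b) <-> rel_le r a b.
Proof. by rewrite /is_in mem_transpose; apply: chi_true. Qed.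

Lemma upsegP W (a b : hom W X) : is_in a (upseg r ∘ b) <-> rel_le r b a.
Proof.
by rewrite /is_in mem_transpose -rel_le_dagger; apply: chi_true.
Qed.

Lemma symmetric_downseg_upseg : symmetric r -> downseg r = upseg r.
Proof.
move=> hs; apply: pow_ext => V h a; rewrite -!/(is_in _ _) downsegP upsegP.
by split; apply: rel_le_sym.
Qed.

End RelationElements.

(** * Adjunctions between power objects *)

Section PowerAdjunctions.
Context (E : topos).

Lemma subset_comp (X V W : E) (h : hom V W) (u v : hom W (pow X)) :
  subset u v -> subset (u ∘ h) (v ∘ h).
Proof. by move=> uv V' h' x; rewrite -!compA; apply: uv. Qed.

(** Transposition form of an adjunction. From it, unit and counit arise at identity morphisms, and
    monotonicity of [f] and [g] by composing with the unit or the counit. *)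
Lemma pow_adjointP (A B : E) (f : hom (pow A) (pow B))
    (g : hom (pow B) (pow A)) :
  adjoint (P := power_pre A) (Q := power_pre B) f g <->
  forall W (u : hom W (pow A)) (v : hom W (pow B)),
    subset (f ∘ u) v <-> subset u (g ∘ v).
Proof.
split=> [[fle gle /power_leP unit /power_leP counit] W u v | H].
  split=> uv.
    apply: (subset_trans (v := g ∘ (f ∘ u))).
      by move: (subset_comp (h := u) unit); rewrite comp_idl -compA.
    by apply/power_leP/gle/power_leP.
  apply: (subset_trans (v := f ∘ (g ∘ v))).
    by apply/power_leP/fle/power_leP.
  by move: (subset_comp (h := v) counit); rewrite comp_idl -compA.
split.
- move=> W a b /power_leP ab; apply/power_leP/H.
  by apply: subset_trans ab _; apply/H; apply: subset_refl.
- move=> W a b /power_leP ab; apply/power_leP/H.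
  by apply: subset_trans ab; apply/H; apply: subset_refl.
- apply/power_leP; rewrite -[f]comp_idr; apply/H.
  by rewrite comp_idr; apply: subset_refl.
- apply/power_leP; rewrite -[g]comp_idr; apply/H.
  by rewrite comp_idr; apply: subset_refl.
Qed.

Lemma inverse_imageP (A B W : E) (f : hom A B) (a : hom W A)
    (v : hom W (pow B)) :
  is_in a (inverse_image f ∘ v) <-> is_in (f ∘ a) v.
Proof.
rewrite /is_in mem_transpose /cross -compA comp_pair -!compA.
by rewrite pr1_pair pr2_pair comp_idl.
Qed.

Lemma direct_imageP (A B W : E) (f : hom A B) (b : hom W B)
    (u : hom W (pow A)) :
  is_in b (direct_image f ∘ u) <->
  factors ⟨b, u⟩ (im_map (image (cross f (idm (pow A)) ∘ mem_sub A))).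
Proof. by rewrite /is_in mem_transpose; apply: chi_true. Qed.

Lemma direct_image_intro (A B W : E) (f : hom A B) (a : hom W A)
    (u : hom W (pow A)) :
  is_in a u -> is_in (f ∘ a) (direct_image f ∘ u).
Proof.
move=> au; apply/direct_imageP; move: au.
rewrite /is_in -(true_comp ⟨a, u⟩) => /eqz_factor [k ek].
have [l el] := im_factor (image (cross f (idm (pow A)) ∘ mem_sub A)).
exists (l ∘ k); rewrite compA -el -compA /mem_sub -ek /cross comp_pair -!compA.
by rewrite pr1_pair pr2_pair comp_idl.
Qed.

(** An element of [∃_f u] need not have a preimage over the same stage, so the step from [u ≤ P f v]
    to [∃_f u ≤ v] tests the impredicative image predicate on one well-chosen subobject [S] of
    [B × PA]. The second coordinate ranges over all of [PA], hence the guard [s = u] in [S]. *)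
Lemma direct_image_adjoint (A B : E) (f : hom A B) :
  adjoint (P := power_pre A) (Q := power_pre B)
    (direct_image f) (inverse_image f).
Proof.
apply/pow_adjointP => W u v; split=> H V h.
  move=> a /(direct_image_intro f) ua.
  by rewrite -compA; apply/inverse_imageP/H; rewrite -compA.
move=> b; rewrite -compA => /direct_imageP /imageP /image_predP.
(* the family, indexed by t : V, of all (b, s) with s = u t -> b ∈ v t *)
pose BP := B × pow A.
pose eq_u := eqO (pow A) ∘ ⟨pr2 B (pow A) ∘ pr1 BP V, u ∘ h ∘ pr2 BP V⟩.
pose in_v := mem B ∘ ⟨pr1 B (pow A) ∘ pr1 BP V, v ∘ h ∘ pr2 BP V⟩.
pose S := transpose (impO eq_u in_v).
have eq_uE V' (c : hom V' B) (s : hom V' (pow A)) (t : hom V' V) :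
    eq_u ∘ ⟨⟨c, s⟩, t⟩ = true_at V' <-> s = u ∘ h ∘ t.
  rewrite /eq_u -compA comp_pair -[pr2 _ _ ∘ _ ∘ _]compA -[_ ∘ pr2 BP V ∘ _]compA.
  by rewrite pr1_pair !pr2_pair eqOP.
have in_vE V' (c : hom V' B) (s : hom V' (pow A)) (t : hom V' V) :
    in_v ∘ ⟨⟨c, s⟩, t⟩ = true_at V' <-> is_in c (v ∘ h ∘ t).
  rewrite /in_v -compA comp_pair -[pr1 _ _ ∘ _ ∘ _]compA -[_ ∘ pr2 BP V ∘ _]compA.
  by rewrite !pr1_pair pr2_pair.
have SP V' (c : hom V' B) (s : hom V' (pow A)) (t : hom V' V) :
    mem BP ∘ ⟨⟨c, s⟩, S ∘ t⟩ = true_at V' <->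
    (forall V2 (k : hom V2 V'),
      s ∘ k = u ∘ h ∘ t ∘ k -> is_in (c ∘ k) (v ∘ h ∘ t ∘ k)).
  rewrite mem_transpose impOP; split=> HS V2 k; move: (HS V2 k);
    by rewrite !comp_pair eq_uE in_vE !compA.
move=> /(_ V (idm V) S); rewrite comp_idr -[S in mem BP ∘ ⟨_, S⟩]comp_idr.
(* Once [S] is known to contain the image of the membership subobject, it contains [⟨b, u ∘ h⟩],
   whose guard holds trivially. *)
move=> Hb; have {}/Hb/SP/(_ V (idm V)) : forall V' (h' : hom V' V) a,
    mem BP ∘ ⟨cross f (idm (pow A)) ∘ mem_sub A ∘ a, S ∘ h'⟩ = true_at V'.
  (* An element of [mem_ob A] is a pair with [a ∈ s]; under the guard, [a ∈ u], and [H] sends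
     [f ∘ a] into [v]. *)
  move=> V' h' m; rewrite -compA (pair_uniq (mem_sub A ∘ m)).
  set a := pr1 _ _ ∘ _; set s := pr2 _ _ ∘ _.
  have sa : is_in a s by rewrite /is_in -pair_uniq compA [mem A ∘ _]eqz_eq !true_comp.
  rewrite /cross comp_pair -!compA pr1_pair pr2_pair comp_idl.
  apply/SP => V2 k es.
  have /H : is_in (a ∘ k) (u ∘ (h ∘ h' ∘ k)).
    by rewrite !compA -es; apply: is_in_comp.
  by rewrite -compA => /inverse_imageP; rewrite !compA.
by rewrite !comp_idr; apply.
Qed.

Lemma bigjoin_adjoint (X : E) :
  adjoint (P := power_pre (pow X)) (Q := power_pre X) (bigjoin X) (down_pow X).
Proof. exact: (proj2_sig (join_sig X)). Qed.

End PowerAdjunctions.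

(** * Interior and closure operators of an equivalence relation *)

Section EquivalenceRelation.
Context (E : topos) (X : E) (r : relation X).
Notation cl := (closure_op r).
Notation int := (interior_op r).

Lemma closure_interior_adjoint : symmetric r ->
  adjoint (P := power_pre X) (Q := power_pre X) cl int.
Proof.
move=> hs; apply/pow_adjointP => W u v.
rewrite /closure_op /interior_op -!compA -(symmetric_downseg_upseg hs).
rewrite (iffLR (pow_adjointP _ _) (bigjoin_adjoint X)).
exact: (iffLR (pow_adjointP _ _) (direct_image_adjoint (downseg r))).
Qed.

Lemma interiorP W (x : hom W X) (u : hom W (pow X)) :
  is_in x (int ∘ u) <->
  forall V (h : hom V W) (y : hom V X), rel_le r (x ∘ h) y -> is_in y (u ∘ h).
Proof.
rewrite /interior_op -compA inverse_imageP down_powP.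
by split=> H V h y xy; apply: H; move: xy; rewrite -compA upsegP.
Qed.

Lemma interior_subset W (u : hom W (pow X)) :
  reflexive r -> subset (int ∘ u) u.
Proof.
move=> hr V h x; rewrite -compA => /interiorP /(_ V (idm V) x).
by rewrite !comp_idr; apply; apply: rel_le_refl.
Qed.

(** By transitivity everything above [y] is above [x]. *)
Lemma interior_saturated W (x y : hom W X) (u : hom W (pow X)) :
  transitive r -> rel_le r x y -> is_in x (int ∘ u) -> is_in y (int ∘ u).
Proof.
move=> ht xy /interiorP H; apply/interiorP => V h z yz; apply: H.
exact: rel_le_trans (rel_le_comp h xy) yz.
Qed.

Lemma interior_subset_interior W (u : hom W (pow X)) :
  transitive r -> subset (int ∘ u) (int ∘ (int ∘ u)).
Proof.
move=> ht V h x xu; rewrite -compA; apply/interiorP => V' h' y xy.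
move: (is_in_comp h' xu); rewrite -(compA int u) -!(compA int).
exact: interior_saturated xy.
Qed.

Context (hr : equivalence_relation r).

Let hrefl : reflexive r. Proof. by case: hr. Qed.
Let htrans : transitive r. Proof. by case: hr => _ []. Qed.
Let hsym : symmetric r. Proof. by case: hr => _ []. Qed.

Lemma closure_subset W (u v : hom W (pow X)) :
  subset (cl ∘ u) v <-> subset u (int ∘ v).
Proof. exact: (iffLR (pow_adjointP _ _) (closure_interior_adjoint hsym)). Qed.

Lemma subset_closure W (u : hom W (pow X)) : subset u (cl ∘ u).
Proof.
by apply: (subset_trans (v := int ∘ (cl ∘ u)));
  [apply/closure_subset/subset_refl | apply: interior_subset].
Qed.

Lemma closure_mono W (u v : hom W (pow X)) :
  subset u v -> subset (cl ∘ u) (cl ∘ v).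
Proof.
by move=> uv; apply/closure_subset; apply: subset_trans uv _; apply/closure_subset.
Qed.

(** Transpose of the comultiplication [int ≤ int int]. *)
Lemma closure_interior_subset W (u : hom W (pow X)) :
  subset (cl ∘ (int ∘ u)) (int ∘ u).
Proof. by apply/closure_subset; apply: interior_subset_interior. Qed.

Lemma closure_closure_subset W (u : hom W (pow X)) :
  subset (cl ∘ (cl ∘ u)) (cl ∘ u).
Proof.
(* Two transpositions leave [u ≤ int (int (cl u))], the unit followed by the comultiplication. *)
apply/closure_subset/closure_subset.
apply: (subset_trans (v := int ∘ (cl ∘ u))); last exact: interior_subset_interior.
by apply/closure_subset.
Qed.

(** Pointwise reading of the unit [u ≤ int (cl u)]. *)
Lemma closure_saturated W (x y : hom W X) (u : hom W (pow X)) :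
  rel_le r x y -> is_in x u -> is_in y (cl ∘ u).
Proof.
move=> xy xu.
have /(_ W (idm W) x) : subset u (int ∘ (cl ∘ u)) by apply/closure_subset.
rewrite !comp_idr => /(_ xu) /interiorP /(_ W (idm W) y).
by rewrite !comp_idr; apply.
Qed.

Lemma subset_imp W (u v w : hom W (pow X)) :
  subset (pow_meet X ∘ ⟨u, v⟩) w <-> subset u (pow_imp X ∘ ⟨v, w⟩).
Proof. by rewrite -!meet_subset; apply: (@himpP _ (power_heyting X)). Qed.

Lemma closure_meet_interior W (a b : hom W (pow X)) :
  cl ∘ (pow_meet X ∘ ⟨a, int ∘ b⟩) = pow_meet X ∘ ⟨cl ∘ a, int ∘ b⟩.
Proof.
apply: subset_anti.
  (* This inclusion needs only that [cl] is monotone and that interiors are closed. *)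
  have [la lb] : subset (pow_meet X ∘ ⟨a, int ∘ b⟩) a /\
                 subset (pow_meet X ∘ ⟨a, int ∘ b⟩) (int ∘ b).
    by split=> V h x; rewrite -compA comp_pair => /pow_meetP [].
  have ca := closure_mono la.
  have cb := subset_trans (closure_mono lb) (@closure_interior_subset _ b).
  move=> V h x xc; rewrite -[pow_meet X ∘ _ ∘ _]compA comp_pair.
  by apply/pow_meetP; split; [apply: ca | apply: cb].
set c := int ∘ b; set w := cl ∘ (pow_meet X ∘ _).
have cP V (k : hom V W) x y : rel_le r x y -> is_in x (c ∘ k) -> is_in y (c ∘ k).
  by rewrite /c -(compA int); apply: interior_saturated.
have wP V (k : hom V W) x y :
    rel_le r x y -> is_in x (a ∘ k) -> is_in x (c ∘ k) -> is_in y (w ∘ k).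
  move=> xy xa xc; rewrite /w -(compA cl); apply: closure_saturated xy _.
  by rewrite -compA comp_pair; apply/pow_meetP.
(* Generalizing over [c] and [w] discards their bodies; from here they enter only through [cP] and
   [wP]. *)
apply/subset_imp/closure_subset; move: c w cP wP => c w cP wP V h x xa.
rewrite -(compA int); apply/interiorP => V' h' y xy.
rewrite -!compA comp_pair; apply/pow_impP => V2 k.
rewrite -!compA => yc.
have xy' : rel_le r (x ∘ (h' ∘ k)) (y ∘ k).
  by rewrite compA; apply: rel_le_comp.
apply: (wP _ _ _ _ xy'); first by rewrite [a ∘ _]compA; apply: is_in_comp.
by apply: cP yc; apply: rel_le_sym.
Qed.

Lemma interior_idempotent : idempotent int.
Proof.
(* Both sides are viewed as applied to the generic element [idm], where the pointwise inclusions
   apply. *)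
rewrite /idempotent -[RHS]comp_idr -{2}(comp_idr int).
by apply: subset_anti; [apply: interior_subset | apply: interior_subset_interior].
Qed.

Lemma closure_idempotent : idempotent cl.
Proof.
rewrite /idempotent -[RHS]comp_idr -{2}(comp_idr cl).
by apply: subset_anti; [apply: closure_closure_subset | apply: subset_closure].
Qed.

Lemma interior_comonad : comonad (P := power_pre X) int.
Proof.
(* Monotonicity is part of the adjunction. *)
have [_ int_le _ _] := closure_interior_adjoint hsym; split=> //.
  by apply/power_leP; rewrite -[int]comp_idr; apply: interior_subset.
by apply/power_leP; rewrite interior_idempotent; apply: subset_refl.
Qed.

Lemma closure_monad : monad (P := power_pre X) cl.
Proof.
have [cl_le _ _ _] := closure_interior_adjoint hsym; split=> //.
  by apply/power_leP; rewrite -[cl]comp_idr; apply: subset_closure.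
by apply/power_leP; rewrite closure_idempotent; apply: subset_refl.
Qed.

End EquivalenceRelation.

Theorem theorem3p21 (E : topos) (X : E) (r : relation X)
    (hr : equivalence_relation r) :
  adjoint (P := power_pre X) (Q := power_pre X) (closure_op r) (interior_op r) /\
  MAO_couple (A := power_heyting X) (interior_op r) (closure_op r).
Proof.
have adj : adjoint (P := power_pre X) (Q := power_pre X)
    (closure_op r) (interior_op r).
  by case: (hr) => _ [_ hs]; apply: closure_interior_adjoint.
split=> //; split; [|split; [|split=> //]].
- by split; [apply: interior_comonad | apply: interior_idempotent].
- by split; [apply: closure_monad | apply: closure_idempotent].
- exact: closure_meet_interior.
Qed.
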